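(* Suppose the limiting marked network $(G,o,\mathcal M(G))$ is a forward-locally-finite multitype tree with responses $f_v=f_{\tau_v}\in\mathsf F_{\mathrm{ne}}$ and the following branching property: at every vertex, conditional on its type, its children's types, and its primitive outgoing exposures, the descendant marked subtrees rooted at the children are independent and have the same type-conditioned rooted laws as the original tree. Assume $B\in L^1(\mathcal T,\mu)$, where $B(t)=\mathfrak b(f_t)$, and that $T_W$ is well defined as a bounded positive operator on $L^1(\mathcal T,\mu)$, with spectral radius $r_1(T_W)<1$. Then there is a random variable $x_o^\star$ such that $$x_o^{-,k}\uparrow x_o^\star,\qquad x_o^{+,k}\downarrow x_o^\star\qquad\text{a.s. as }k\to\infty .$$ In particular, $x_o^{+,k}-x_o^{-,k}\to0$ a.s. (root coalescence).
   Context: $\mathcal T$ is a Polish space of types. $\mathsf F_{\mathrm{ne}}$ is the set of bounded, nonnegative, nondecreasing, $1$-Lipschitz functions $f:\mathbb R\to\mathbb R$ (with the uniform metric), and $\mathfrak b(f):=\sup_zf(z)$. $(f_t)_{t\in\mathcal T}$ is a measurable family of elements of $\mathsf F_{\mathrm{ne}}$. The limiting network is a random rooted marked directed graph $(G,o,\mathcal M(G))$, all of whose vertices are reachable from the root $o$ by directed paths and have finite out-degree (forward local finiteness); each vertex $v$ has a mark $(\tau_v,\epsilon_v,f_v)\in\mathcal T\times\mathbb R\times\mathsf F_{\mathrm{ne}}$ (type, shock, response) and each edge $(v,u)$ a primitive exposure $C_{vu}>0$. For a tree, edges are directed from parents to children. ''Type-conditioned rooted laws'' means: the subtree at a child $u$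 has conditional law equal to that of the whole tree given $\tau_o=t$, evaluated at $t=\tau_u$. Weights: $W_{vu}=C_{vu}/\sum_{w:(v,w)\in E(G)}C_{vw}$ for $(v,u)\in E(G)$ and $0$ otherwise; vertices without outgoing edges have zero network input. Extremal iterates: $x_v^{-,0}=0$, $x_v^{+,0}=\mathfrak b(f_v)$, and $x_v^{\pm,k+1}=f_v\bigl(\sum_{u:(v,u)\in E(G)}W_{vu}x_u^{\pm,k}+\epsilon_v\bigr)$ for $v\in V(G)$, $k\ge0$. $\mu$ is the law of the root type $\tau_o$. $Q_W$ is a measurable version of the kernel $Q_W(s,A)=\mathbb E\bigl[\sum_{u:(o,u)\in E(G)}W_{ou}\mathbf 1_{\{\tau_u\in A\}}\,\big|\,\tau_o=s\bigr]$, $A\subseteq\mathcal T$ Borel; for measurable $h:\mathcal T\to[0,\infty]$, $(T_Wh)(s)=\int h(t)\,Q_W(s,dt)$. Identities involving conditional laws are understood $\mu$-almost everywhere. $r_1(T_W)$ is the spectral radius of $T_W$ on $L^1(\mathcal T,\mu)$. The arrows $\uparrow,\downarrow$ denote monotone convergence. *)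

(* Defs.v *)
From HB Require Import structures.
From mathcomp Require Import all_boot all_order all_algebra.
From mathcomp Require Import complex.
From mathcomp Require Import all_classical all_reals all_analysis.

Set Implicit Arguments.
Unset Strict Implicit.
Unset Printing Implicit Defensive.

Import Order.TTheory GRing.Theory Num.Theory.
Import numFieldNormedType.Exports.

Local Open Scope classical_set_scope.
Local Open Scope ring_scope.

(* The Borel sigma-algebra, carried by an alias of the space. *)
Definition borelType (X : ptopologicalType) := g_sigma_algebraType (@open X).
HB.instance Definition _ (X : ptopologicalType) :=
  Measurable.on (borelType X).

Section responses.
Context {R : realType}.

Definition Fne (f : R -> R) : Prop :=
  [/\ bounded_fun f, (forall z, 0 <= f z),
      {homo f : z z' / z <= z'} & 1.-lipschitz f].

Definition bsup (f : R -> R) : R := sup (range f).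

(* Borel measurability for the topology of uniform convergence; when f takes
   its values in Fne, traces on Fne of open sets have the same preimages. *)
Definition measurable_family d (T : measurableType d) (f : T -> R -> R) :=
  forall U : set {uniform R -> R}, open U -> measurable (f @^-1` U).

End responses.

(* Rooted trees with finite out-degrees are encoded by Ulam-Harris words: the
   root is [::] and the children of v are rcons v 0, ..., rcons v (deg x v - 1).
   The fields are total functions, but their values at words that are not
   vertices (resp. at pairs that are not edges) are never observed: neither by
   the sigma-algebra below, nor by the iterates at the root. *)
Definition word := seq nat.

Record mtree (T : Type) (R : realType) := MTree {
  deg : word -> nat ;
  typ : word -> T ;
  shock : word -> R ;
  expo : word -> word -> {posnum R} }.

Section trees.
Context {T : Type} {R : realType}.
Implicit Types (x : mtree T R) (v u : word).

Definition vertices x : set word :=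
  [set v | forall k, (k < size v)%N -> (nth 0 v k < deg x (take k v))%N].

Definition children x v : seq word := [seq rcons v i | i <- iota 0 (deg x v)].

Definition edge x v u : Prop := vertices x v /\ u \in children x v.

Definition weight x v u : R :=
  if `[< edge x v u >] then
    (expo x v u)%:num / \sum_(w <- children x v) (expo x v w)%:num
  else 0.

Definition subtree x v : mtree T R :=
  MTree (fun w => deg x (v ++ w)) (fun w => typ x (v ++ w))
        (fun w => shock x (v ++ w)) (fun w w' => expo x (v ++ w) (v ++ w')).

Definition root_typ x : T := typ x [::].

(* phi v is the response f_v of the vertex v. *)
Definition update x (phi : word -> R -> R) (y : word -> R) : word -> R :=
  fun v => phi v (\sum_(u <- children x v) weight x v u * y u + shock x v).

Definition xminus x phi (k : nat) : word -> R :=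
  iter k (update x phi) (fun=> 0).

Definition xplus x phi (k : nat) : word -> R :=
  iter k (update x phi) (fun v => bsup (phi v)).

End trees.

Section tree_measurable.
Context d (T : measurableType d) (R : realType).
Notation tree := (mtree T R).

Definition deg_events (v : word) : set (set tree) :=
  [set E | exists n, E = [set x | vertices x v /\ deg x v = n]].

Definition typ_events (v : word) : set (set tree) :=
  [set E | exists2 A, measurable A & E = [set x | vertices x v /\ A (typ x v)]].

Definition shock_events (v : word) : set (set tree) :=
  [set E | exists2 A, measurable A &
    E = [set x | vertices x v /\ A (shock x v)]].

Definition expo_events (v : word) : set (set tree) :=
  [set E | exists u, exists2 A, measurable A &
    E = [set x | edge x v u /\ A (expo x v u)%:num]].

Definition tree_events : set (set tree) :=
  \bigcup_v (deg_events v `|` typ_events v `|` shock_events v `|`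
             expo_events v).

(* What is conditioned upon at v: its type, its number of children, their
   types and the exposures of v to them. *)
Definition star_events (v : word) : set (set tree) :=
  deg_events v `|` typ_events v `|` \bigcup_i typ_events (rcons v i) `|`
  expo_events v.

HB.instance Definition _ := gen_eqMixin tree.
HB.instance Definition _ := gen_choiceMixin tree.
HB.instance Definition _ := isPointed.Build tree
  (MTree (fun=> 0%N) (fun=> point) (fun=> 0) (fun _ _ => 1%:pos)).
HB.instance Definition _ := @isMeasurable.Build (sigma_display tree_events)
  tree <<s tree_events>> (@sigma_algebra0 _ setT tree_events)
  (@sigma_algebraC tree tree_events) (@sigma_algebra_bigcup _ setT tree_events).

Lemma measurable_root_typ : measurable_fun [set: tree] root_typ.
Proof.
move=> _ A mA; rewrite setTI; apply: sub_sigma_algebra.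
exists [::] => //; left; left; right; exists A => //.
by apply/seteqP; split => [x Ax|x []//].
Qed.

HB.instance Definition _ :=
  isMeasurableFun.Build _ _ tree T root_typ measurable_root_typ.

End tree_measurable.

Section random_trees.
Context dO d (Omega : measurableType dO) (T : measurableType d) (R : realType).
Notation tree := (mtree T R).
Variables (P : probability Omega R) (X : {RV P >-> tree}).
Local Open Scope ereal_scope.

Definition root_law : probability T R := distribution P (@root_typ T R \o X).

(* K is a regular version of the conditional law of X given its root type. *)
Definition type_conditioned_law (K : R.-pker T ~> tree) :=
  forall (A : set T) (S : set tree), measurable A -> measurable S ->
    P (X @^-1` (root_typ @^-1` A `&` S)) = \int[root_law]_(t in A) K t S.

(* Conditionally on the star of v, on the event that v is a vertex with n
   children, the subtrees at the children are independent, the one at a child u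
   with law K (typ u); E ranges over the conditioning sigma-algebra. *)
Definition branching (K : R.-pker T ~> tree) :=
  forall (v : word) (n : nat) (E : set tree) (S : nat -> set tree),
    <<s star_events v>> E -> (forall i, measurable (S i)) ->
    let E' := E `&` [set x | vertices x v /\ deg x v = n] in
    P (X @^-1` (E' `&` [set x | forall i, (i < n)%N ->
                                  S i (subtree x (rcons v i))])) =
    \int[P]_(w in X @^-1` E')
      (\prod_(i < n) fine (K (typ (X w) (rcons v i)) (S i)))%:E.

Definition is_QW (Q : R.-ker T ~> T) :=
  forall A A' : set T, measurable A -> measurable A' ->
    \int[root_law]_(s in A') Q s A =
    \int[P]_(w in X @^-1` (root_typ @^-1` A'))
      (\sum_(u <- children (X w) [::])
         weight (X w) [::] u * \1_A (typ (X w) u))%:E.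

End random_trees.

Section L1_operator.
Context d (T : measurableType d) (R : realType).
Variables (mu : {measure set T -> \bar R}) (Q : R.-ker T ~> T).

Definition TW (h : T -> \bar R) (s : T) : \bar R := (\int[Q s]_t h t)%E.

(* Linearity (almost everywhere) on integrable functions is that of the
   integral. *)
Definition TW_bounded_positive_on_L1 :=
  [/\ forall h h' : T -> \bar R,
        mu.-integrable setT h -> mu.-integrable setT h' ->
        ae_eq mu setT h h' -> ae_eq mu setT (TW h) (TW h'),
      forall h : T -> \bar R, (forall t, 0 <= h t)%E ->
        forall s, (0 <= TW h s)%E &
      exists M : R, forall h : T -> \bar R, mu.-integrable setT h ->
        mu.-integrable setT (TW h) /\
        (\int[mu]_s `|TW h s| <= M%:E * \int[mu]_s `|h s|)%E].

(* The complexification of L^1(mu), through representatives, and of TW. *)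
Definition L1C (f : T -> R[i]) : Prop :=
  (fun t => complex.Re (f t)) \in Lfun mu 1%E /\
  (fun t => complex.Im (f t)) \in Lfun mu 1%E.

Definition normL1C (f : T -> R[i]) : \bar R :=
  (\int[mu]_t (complex.Re `|f t|)%:E)%E.

Definition TWC (f : T -> R[i]) (s : T) : R[i] :=
  Complex (fine (TW (fun t => (complex.Re (f t))%:E) s))
          (fine (TW (fun t => (complex.Im (f t))%:E) s)).

Definition resolventC (z : R[i]) (f : T -> R[i]) (s : T) : R[i] :=
  z * f s - TWC f s.

(* z - TW is a bijection of the complex L^1(mu) with a bounded inverse. *)
Definition resolvent_set : set R[i] :=
  [set z |
    (forall f g, L1C f -> L1C g ->
       ae_eq mu setT (resolventC z f) (resolventC z g) -> ae_eq mu setT f g) /\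
    exists M : R, forall g, L1C g -> exists f,
      [/\ L1C f, ae_eq mu setT (resolventC z f) g &
          (normL1C f <= M%:E * normL1C g)%E]].

Definition spectrum : set R[i] := ~` resolvent_set.

Definition spectral_radius : \bar R :=
  ereal_sup [set (complex.Re `|z|)%:E | z in spectrum].

End L1_operator.

(* Main.v *)
Require Import Defs.
From HB Require Import structures.
From mathcomp Require Import all_boot all_order all_algebra.
From mathcomp Require Import complex.
From mathcomp Require Import all_classical all_reals all_analysis.
From mathcomp Require Import measurable_realfun.
From mathcomp Require Import ring lra.

Set Implicit Arguments.
Unset Strict Implicit.
Unset Printing Implicit Defensive.

Import Order.TTheory GRing.Theory Num.Theory.
Import numFieldNormedType.Exports.

Local Open Scope classical_set_scope.
Local Open Scope ring_scope.

(** After k steps the two extremal iterates at the root differ by at most S_k,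
    the weighted average over generation k of the bounds B of the responses.
    The expectation of S_k is the integral of T_W^k B, which tends to 0 because
    the spectral radius is below 1.  The proof has three independent
    ingredients.

    Deterministic comparison.  The responses are nondecreasing and 1-Lipschitz
    and the weights are nonnegative, so the lower iterates increase, the upper
    ones decrease, and the gap at a vertex is at most the weighted average of
    the gaps at its children one step earlier.  Starting from B, k such averages
    give a random variable S_k that dominates the gap at the root
    ([root_gap_le]).

    Many-to-one.  The recursion defining S_k involves only the star of the root
    and the subtrees at its children.  Conditionally on the star, the branching
    property replaces each subtree by its type-conditioned law, and what remains
    is an average over the types of the children, whose conditional mean is
    integration against Q_W.  By induction, S_k has conditional mean T_W^k B
    given the root type ([integral_propagate]).  The passage from sets to
    functions is always the same fact: two mixtures of measures that agree on
    sets agree on nonnegative functions ([eq_integral_mixture]).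

    Decay of the mass of T_W^k B.  Positivity makes the behaviour of the
    resolvent on the half-line [1, +oo[ sufficient, so that no complex analysis
    is needed.  If a_k is the mass of T_W^k B and the Neumann series at a real
    point l' converges, its sum g solves (l' - T_W) g = T_W^n B, and the bound M
    of the resolvent at a nearby real l yields
    [mass of g <= M (a_n + |l' - l| mass of g)].  If the optimal
    geometric rate of (a_k) were at least 1, taking it for l would produce a
    strictly better rate; so it is below 1 and a_k tends to 0
    ([cvg0_of_resolvent_bounds], [cvg0_integral_iter_TW]).

    The gap at the root decreases to a limit whose expectation is at most every
    E S_k, hence vanishes almost surely ([ae_eq_limn_root]). *)

(** * Geometric decay from bounded resolvents *)

Section geometric_rates.
Context {R : realType}.
Implicit Types (a : R^nat) (l r : R).

Definition resolvent_series a l (n : nat) : R^nat :=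
  series (fun k => l ^- k.+1 * a (n + k)%N).

Lemma resolvent_series_cvg a l r C n : (forall n, 0 <= a n) ->
  0 <= r -> r < l -> (forall n, a n <= C * r ^+ n) ->
  cvgn (resolvent_series a l n).
Proof.
move=> a0 r0 rl aC.
have l0 : 0 < l by exact: le_lt_trans rl.
have C0 : 0 <= C by have := aC 0%N; rewrite expr0 mulr1; exact: le_trans.
have lk k : 0 < l ^- k by rewrite invr_gt0 exprn_gt0.
apply: (@series_le_cvg _ _ (geometric (C * r ^+ n / l) (r / l))).
- by move=> k; rewrite mulr_ge0 // ltW.
- by move=> k; rewrite mulr_ge0 ?exprn_ge0 ?divr_ge0 ?mulr_ge0 ?exprn_ge0 // ltW.
- move=> k /=; rewrite (le_trans (ler_wpM2l (ltW (lk _)) (aC _))) //.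
  rewrite exprD exprS invfM expr_div_n.
  by rewrite le_eqVlt; apply/orP; left; apply/eqP; ring.
- apply: is_cvg_geometric_series.
  by rewrite ger0_norm ?divr_ge0 ?(ltW l0) // ltr_pdivrMr // mul1r.
Qed.

Lemma resolvent_series_rec a l n : l != 0 ->
  cvgn (resolvent_series a l n) -> cvgn (resolvent_series a l n.+1) ->
  l * limn (resolvent_series a l n) = a n + limn (resolvent_series a l n.+1).
Proof.
move=> l0 cn cn1.
have c1 : (resolvent_series a l n) k.+1 @[k --> \oo] -->
    limn (resolvent_series a l n) by rewrite (cvg_shiftS (resolvent_series a l n)).
have c2 : l * (resolvent_series a l n) k.+1 @[k --> \oo] -->
    l * limn (resolvent_series a l n) by apply: cvgM => //; exact: cvg_cst.
have c3 : a n + (resolvent_series a l n.+1) k @[k --> \oo] -->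
    a n + limn (resolvent_series a l n.+1) by apply: cvgD => //; exact: cvg_cst.
apply: (cvg_unique _ c2) => //.
suff /funext -> : (fun k => l * (resolvent_series a l n) k.+1) =1
          (fun k => a n + (resolvent_series a l n.+1) k) by exact: c3.
move=> k; rewrite /resolvent_series /series /=.
rewrite big_nat_recl // mulrDr addn0 expr1 mulrA divff // mul1r mulr_sumr.
congr (_ + _); apply: eq_bigr => i _.
by rewrite addnS exprS invfM !mulrA divff // mul1r.
Qed.

(** The hypothesis is what a resolvent that is bounded at every real l >= 1 says
    about the masses a_n of the iterates of a positive operator: the sum g_n of
    the Neumann series at l' of the n-th iterate solves an equation at l with
    right-hand side of mass at most a_n + |l' - l| g_n.  Let rho be the infimum
    of the geometric rates of a and suppose rho >= 1.  With l := rho and l'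
    slightly above rho, the error term is absorbed and g_n <= 2 M a_n; since
    g_(n+1) = l' g_n - a_n, the g_n, and with them the a_n, decay at the rate
    l' - 1/(2M) < rho, a contradiction. *)
Lemma cvg0_of_resolvent_bounds a C0 : (forall n, 0 <= a n) ->
  (forall n, a n.+1 <= C0 * a n) ->
  (forall l, 1 <= l -> exists M, forall l' n, 1 <= l' ->
    cvgn (resolvent_series a l' n) ->
    limn (resolvent_series a l' n) <=
      M * (a n + `|l' - l| * limn (resolvent_series a l' n))) ->
  a n @[n --> \oo] --> 0.
Proof.
move=> a0 aC0 aM.
pose rates : set R := [set r | 0 <= r /\ exists C, forall n, a n <= C * r ^+ n].
have rates0 : rates !=set0.
  exists (Num.max 0 C0); split; first by rewrite le_max lexx.
  exists (a 0%N); elim => [|n ih]; first by rewrite expr0 mulr1.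
  rewrite (le_trans (aC0 n)) // exprS mulrCA.
  rewrite (le_trans (ler_wpM2r (a0 n) (_ : C0 <= Num.max 0 C0))) //.
    by rewrite le_max lexx orbT.
  by rewrite ler_wpM2l // le_max lexx.
have ratesl : has_lbound rates by exists 0 => r [].
have rates_inf : has_inf rates by [].
have ltx x : inf rates < x -> exists2 r, rates r & r < x.
  by rewrite -subr_gt0 => /inf_adherent /(_ rates_inf); rewrite addrC subrK.
have [rho1|rho1] := ltP (inf rates) 1.
  have /ltx[r [r0 [C aC]] r1] : inf rates < 1 by [].
  have cC : C * r ^+ n @[n --> \oo] --> 0.
    rewrite -[X in _ --> X](mulr0 C); apply: cvgM; first exact: cvg_cst.
    by apply: cvg_expr; rewrite ger0_norm.
  apply: (squeeze_cvgr _ (cvg_cst 0) cC).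
  by apply: nearW => n; rewrite a0 aC.
exfalso.
have [M' aM'] := aM _ rho1; set rho := inf rates in rho1 aM'.
(* M >= 1 makes the improved rate t >= 0. *)
pose M := Num.max 1 M'.
have M1 : 1 <= M by rewrite le_max lexx.
have M0 : 0 < M by exact: lt_le_trans M1.
(* Half of the gain 1/(2M) is spent on the step above rho. *)
pose l := rho + (4 * M)^-1.
have Mi : 0 < (4 * M)^-1 by rewrite invr_gt0 mulr_gt0.
have Mi1 : (4 * M)^-1 <= 4^-1.
  by rewrite lef_pV2 ?posrE ?mulr_gt0 // ler_peMr.
have l1 : 1 <= l by rewrite /l; lra.
have l0 : 0 < l by lra.
have /ltx[r [r0 [C aC]] rl] : inf rates < l.
  by rewrite -/rho /l; lra.
have cv n : cvgn (resolvent_series a l n).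
  exact: (@resolvent_series_cvg a l r C n a0 r0 rl aC).
pose s n := limn (resolvent_series a l n).
have s0 n : 0 <= s n.
  apply: limr_ge; first exact: cv.
  apply: nearW => N; rewrite /resolvent_series /series /=; apply: sumr_ge0 => k _.
  by rewrite mulr_ge0 // invr_ge0 exprn_ge0 // ltW.
have srec n : l * s n = a n + s n.+1.
  by apply: resolvent_series_rec => //; rewrite gt_eqF.
have sM n : s n <= 2 * M * a n.
  have := aM' l n l1 (cv n); rewrite -/(s n).
  rewrite (_ : l - rho = (4 * M)^-1); last by rewrite /l; ring.
  rewrite (ger0_norm (ltW Mi)).
  have h : 0 <= a n + (4 * M)^-1 * s n by rewrite addr_ge0 // mulr_ge0 // ltW.
  have M'M : M' <= M by rewrite le_max lexx orbT.
  move=> /le_trans /(_ (ler_wpM2r h M'M)).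
  rewrite mulrDr mulrA (_ : M * (4 * M)^-1 = 4^-1); last first.
    by field; rewrite gt_eqF.
  have := mulr_ge0 (ltW M0) (a0 n).
  rewrite -(mulrA 2); set p := M * a n => p0; set q := s n => pq; lra.
pose t := rho - (4 * M)^-1.
have t0 : 0 <= t by rewrite /t; lra.
have st n : s n.+1 <= t * s n.
  have -> : s n.+1 = l * s n - a n by rewrite srec; ring.
  have : (2 * M)^-1 * s n <= a n.
    by rewrite ler_pdivrMl ?mulr_gt0.
  rewrite (_ : (2 * M)^-1 = 2 * (4 * M)^-1); last by field; rewrite gt_eqF.
  rewrite /l /t mulrBl -(mulrA 2) (mulrDl rho).
  set p := (4 * M)^-1 * s n; set q := rho * s n; lra.
have : rates t.
  split => //; exists (l * s 0%N) => n.
  have an : a n <= l * s n by rewrite srec lerDl.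
  apply: (le_trans an); rewrite -mulrA; apply: ler_wpM2l; first exact: ltW.
  elim: n {an} => [|n ih]; first by rewrite expr0 mulr1.
  by rewrite (le_trans (st n)) // exprS mulrCA ler_wpM2l.
move=> /(ge_inf ratesl); rewrite -/rho /t; lra.
Qed.

End geometric_rates.

(** * Mixtures of measures *)

Section mixtures.
Context {R : realType} {d} {Y : measurableType d}.
Local Open Scope ereal_scope.

Import HBNNSimple.

Section one_mixture.
Context d' (O : measurableType d') (m : {measure set O -> \bar R}) (D : set O).
Variable kappa : O -> {measure set Y -> \bar R}.
Hypothesis mD : measurable D.
Hypothesis mkappa : forall A, measurable A ->
  measurable_fun D (fun w => kappa w A : \bar R).

Let measurable_integral_nnsfun (g : {nnsfun Y >-> R}) :
  measurable_fun D (fun w => \int[kappa w]_y (g y)%:E).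
Proof.
under eq_fun do rewrite integralT_nnsfun sintegralE.
by apply: emeasurable_fsum => //= r; apply: measurable_funeM; exact: mkappa.
Qed.

Let cvg_integral_nnsfun (h : Y -> \bar R) (mh : measurable_fun setT h) w :
  (forall y, 0 <= h y) ->
  \int[kappa w]_y (nnsfun_approx measurableT mh n y)%:E @[n --> \oo] -->
  \int[kappa w]_y h y.
Proof.
move=> h0.
rewrite (_ : \int[kappa w]_y h y =
    \int[kappa w]_y limn (fun n => (nnsfun_approx measurableT mh n y)%:E)).
  apply: cvg_monotone_convergence => //.
  - by move=> n; exact/measurable_EFinP.
  - by move=> n x _; rewrite lee_fin.
  - by move=> t _ n k nk; rewrite lee_fin; exact/lefP/nd_nnsfun_approx.
apply: eq_integral => t _.
by apply/esym/cvg_lim => //; exact/cvg_nnsfun_approx.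
Qed.

Lemma integral_mixture (h : Y -> \bar R) (mh : measurable_fun setT h) :
  (forall y, 0 <= h y) ->
  \int[m]_(w in D) \int[kappa w]_y h y =
  limn (fun n => let g := nnsfun_approx measurableT mh n in
    \sum_(r \in range g) (r%:E * \int[m]_(w in D) kappa w (g @^-1` [set r]))).
Proof.
move=> h0; pose g := nnsfun_approx measurableT mh.
rewrite (_ : \int[m]_(w in D) _ =
  \int[m]_(w in D) limn (fun n => \int[kappa w]_y (g n y)%:E)); last first.
  by apply: eq_integral => w _; apply/esym/cvg_lim => //; exact: cvg_integral_nnsfun.
rewrite monotone_convergence //.
- congr (limn _); apply/funext => n /=.
  under eq_integral do rewrite integralT_nnsfun sintegralE.
  rewrite ge0_integral_fsum //=.
  + apply: eq_fsbigr => r; rewrite inE => -[y _ <-].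
    by rewrite ge0_integralZl ?lee_fin //; apply: mkappa.
  + by move=> r; apply: measurable_funeM; exact: mkappa.
  + by move=> r w _; exact: nnsfun_mulemu_ge0.
- by move=> n w _; apply: integral_ge0 => y _; rewrite lee_fin.
- move=> w _ n k nk; apply: ge0_le_integral => //.
  + by move=> y _; rewrite lee_fin.
  + exact/measurable_EFinP.
  + exact/measurable_EFinP.
  + by move=> y _; rewrite lee_fin; exact/lefP/nd_nnsfun_approx.
Qed.

End one_mixture.

(** This is how every identity between laws is transferred from events to
    nonnegative functions: both sides are limits of the same linear combinations
    of their values on level sets of simple functions ([integral_mixture]). *)
Lemma eq_integral_mixture d1 d2 (O1 : measurableType d1)
    (O2 : measurableType d2) (m1 : {measure set O1 -> \bar R})
    (m2 : {measure set O2 -> \bar R}) (D1 : set O1) (D2 : set O2)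
    (k1 : O1 -> {measure set Y -> \bar R})
    (k2 : O2 -> {measure set Y -> \bar R}) (h : Y -> \bar R) :
  measurable D1 -> measurable D2 ->
  (forall A, measurable A -> measurable_fun D1 (fun w => k1 w A : \bar R)) ->
  (forall A, measurable A -> measurable_fun D2 (fun w => k2 w A : \bar R)) ->
  (forall A, measurable A ->
    \int[m1]_(w in D1) k1 w A = \int[m2]_(w in D2) k2 w A) ->
  measurable_fun setT h -> (forall y, 0 <= h y) ->
  \int[m1]_(w in D1) \int[k1 w]_y h y = \int[m2]_(w in D2) \int[k2 w]_y h y.
Proof.
move=> mD1 mD2 mk1 mk2 k12 mh h0; rewrite !(integral_mixture _ _ _ mh) //.
congr (limn _); apply/funext => n /=; apply: eq_fsbigr => r _.
by rewrite k12.
Qed.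

End mixtures.

(** * Iterates of a positive operator on L^1 *)

Section L1_decay.
Context d (T : measurableType d) (R : realType).
Variables (mu : {measure set T -> \bar R}) (Q : R.-ker T ~> T).
Hypothesis TW_L1 : TW_bounded_positive_on_L1 mu Q.
Local Notation TW := (@TW d T R Q).
Local Open Scope ereal_scope.

Lemma measurable_TW (h : T -> \bar R) :
  measurable_fun setT h -> (forall t, 0 <= h t) -> measurable_fun setT (TW h).
Proof.
move=> mh h0; apply: measurable_fun_integral_kernel => // U.
exact: measurable_kernel.
Qed.

Lemma integrable_TW (h : T -> \bar R) :
  mu.-integrable setT h -> mu.-integrable setT (TW h).
Proof. by case: TW_L1 => _ _ [M HM] /HM[]. Qed.

Lemma integrable_fine_Lfun (h : T -> \bar R) :
  mu.-integrable setT h -> fine \o h \in Lfun mu 1.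
Proof.
move=> ih; apply/Lfun1_integrable; apply/integrableP; split.
  apply/measurable_EFinP; apply: measurableT_comp => //.
  exact: measurable_int ih.
have /integrableP[mh] := ih; apply: le_lt_trans.
apply: ge0_le_integral => //.
- by apply/measurable_EFinP; do 2 apply: measurableT_comp => //.
- exact: measurableT_comp.
- by move=> x _ /=; case: (h x) => [r||] //=; rewrite leey.
Qed.

Lemma ae_fineK (h : T -> \bar R) :
  mu.-integrable setT h -> ae_eq mu setT (EFin \o fine \o h) h.
Proof.
move=> /(integrable_ae measurableT); apply: filterS => x /(_ I) hx _ /=.
exact: fineK.
Qed.

Local Notation realC f := (fun t => Complex (f t) 0%R).

Lemma L1C_real (u : T -> R) : u \in Lfun mu 1 -> L1C mu (realC u).
Proof. by move=> uL; split => //=; exact: rpred0. Qed.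

Lemma resolvent_set_gt_radius (z : R[i]) (r : R) : spectral_radius mu Q < r%:E ->
  (r <= complex.Re `|z|)%R -> resolvent_set mu Q z.
Proof.
move=> Qr rz; apply: contrapT => spz.
have : ((complex.Re `|z|%R)%:E <= spectral_radius mu Q).
  by apply: ereal_sup_ubound; exists z.
by move=> /le_lt_trans /(_ Qr); rewrite lte_fin ltNge rz.
Qed.

Lemma Re_normC (z : R[i]) :
  complex.Re `|z|%R = Num.sqrt (complex.Re z ^+ 2 + complex.Im z ^+ 2)%R.
Proof. by have := congr1 (@complex.Re R) (normc_def z). Qed.

Lemma measurable_normC (f : T -> R[i]) : L1C mu f ->
  measurable_fun setT (fun t => complex.Re `|f t|%R).
Proof.
move=> [/sub_Lfun_mfun]; rewrite inE /= => mRe /sub_Lfun_mfun; rewrite inE /= => mIm.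
rewrite (_ : (fun t => _) = (fun t =>
  Num.sqrt (complex.Re (f t) ^+ 2 + complex.Im (f t) ^+ 2))%R).
  apply: (measurableT_comp (f := @Num.sqrt R)); last first.
    by apply: measurable_funD; exact: measurable_funX.
  apply: continuous_measurable_fun => x; exact: sqrt_continuous.
by apply/funext => t; exact: Re_normC.
Qed.

Lemma ae_eq_normL1C (f g : T -> R[i]) : L1C mu f -> L1C mu g ->
  ae_eq mu setT f g -> normL1C mu f = normL1C mu g.
Proof.
move=> fL gL fg; apply: ge0_ae_eq_integral => //.
- by apply/measurable_EFinP; exact: measurable_normC.
- by apply/measurable_EFinP; exact: measurable_normC.
- by move=> x _; rewrite lee_fin Re_normC sqrtr_ge0.
- by move=> x _; rewrite lee_fin Re_normC sqrtr_ge0.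
- by move: fg; apply: filterS => x /(_ I) fgx _; rewrite fgx.
Qed.

(** The resolvent is defined on complex functions, but on a real point it
    controls real functions: u is the only solution of the resolvent equation
    with right-hand side l u - T_W u. *)
Lemma L1_resolvent_bound (l : R) : resolvent_set mu Q (Complex l 0%R) ->
  exists2 M : R, (0 <= M)%R & forall u : T -> R, u \in Lfun mu 1 ->
  \int[mu]_t `|u t|%R%:E <=
  M%:E * \int[mu]_t (`|l * u t - fine (TW (EFin \o u) t)|)%R%:E.
Proof.
case=> inj [M HM]; exists (Num.max 0%R M); first by rewrite le_max lexx.
move=> u uL; pose v t := (l * u t - fine (TW (EFin \o u) t))%R.
have TWuL : fine \o TW (EFin \o u) \in Lfun mu 1.
  by apply: integrable_fine_Lfun; apply: integrable_TW => //; exact/Lfun1_integrable.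
have vL : v \in Lfun mu 1.
  rewrite (_ : v = (l *: u - (fine \o TW (EFin \o u)))%R) ?rpredB ?rpredZ //.
have uE : resolventC Q (Complex l 0%R) (realC u) = realC v.
  apply/funext => t; rewrite /resolventC /TWC /=.
  have -> : TW (fun t => 0%R%:E) t = 0 by exact: integral0.
  by apply/eqP; rewrite eq_complex /= !mulr0 !mul0r subr0 addr0 subr0 !eqxx.
have [g [gL gv gM]] := HM _ (L1C_real vL).
have gu : ae_eq mu setT g (realC u).
  by apply: inj => //; [exact: L1C_real|rewrite uE].
have normC (w : T -> R) : w \in Lfun mu 1 ->
  normL1C mu (realC w) = \int[mu]_t `|w t|%R%:E.
  move=> _; apply: eq_integral => t _.
  by rewrite Re_normC /= expr0n addr0 sqrtr_sqr.
rewrite -(normC u) // -(normC v) // -(ae_eq_normL1C gL (L1C_real uL) gu).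
apply: (le_trans gM); apply: lee_wpmul2r.
  by apply: integral_ge0 => t _; rewrite lee_fin Re_normC sqrtr_ge0.
by rewrite lee_fin le_max lexx orbT.
Qed.

Section nonneg.
Variable h0 : T -> \bar R.
Hypothesis h0_ge0 : forall t, 0 <= h0 t.
Hypothesis h0_int : mu.-integrable setT h0.
Let h k := iter k TW h0.

Lemma iter_TW_ge0 k t : 0 <= h k t.
Proof.
by elim: k t => [|k ih] t //=; apply: integral_ge0 => u _; exact: ih.
Qed.

Lemma integrable_iter_TW k : mu.-integrable setT (h k).
Proof. by elim: k => //= k ih; exact: integrable_TW. Qed.

Let mh k : measurable_fun setT (h k).
Proof. exact: measurable_int (integrable_iter_TW k). Qed.

Let a k := fine (\int[mu]_t h k t).

Lemma integral_iter_TW k : \int[mu]_t h k t = (a k)%:E.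
Proof. by rewrite /a fineK // integrable_fin_num //; exact: integrable_iter_TW. Qed.

Let a_ge0 k : (0 <= a k)%R.
Proof. by rewrite fine_ge0 // integral_ge0 // => t _; exact: iter_TW_ge0. Qed.

Let g (l : R) n t := \sum_(k <oo) ((l ^- k.+1)%:E * h (n + k) t).

Section resolvent.
Variables (l : R) (n : nat).
Hypothesis l_gt0 : (0 < l)%R.

Let li k : 0 <= (l ^- k)%:E.
Proof. by rewrite lee_fin invr_ge0 exprn_ge0 // ltW. Qed.

Let term_ge0 k t : 0 <= (l ^- k.+1)%:E * h (n + k) t.
Proof. by rewrite mule_ge0 // iter_TW_ge0. Qed.

Let mterm k : measurable_fun setT (fun t => (l ^- k.+1)%:E * h (n + k) t).
Proof. exact: measurable_funeM. Qed.

Let g_ge0 t : 0 <= g l n t.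
Proof. by apply: nneseries_ge0 => k _ _; exact: term_ge0. Qed.

Let mg : measurable_fun setT (g l n).
Proof. by apply: ge0_emeasurable_sum => // k t _ _; exact: term_ge0. Qed.

Lemma integral_neumann : cvgn (resolvent_series a l n) ->
  \int[mu]_t g l n t = (limn (resolvent_series a l n))%:E.
Proof.
move=> cv; rewrite integral_nneseries // -EFin_lim //.
congr (limn _); apply/funext => N /=.
rewrite /resolvent_series /series /= -sumEFin; apply: eq_bigr => k _.
by rewrite ge0_integralZl // ?integral_iter_TW // => t _; exact: iter_TW_ge0.
Qed.

(** Everything is nonnegative, so this holds at every point, including where both
    sides are infinite. *)
Lemma neumann_resolvent t : l%:E * g l n t = h n t + TW (g l n) t.
Proof.
have TWg : TW (g l n) t = \sum_(k <oo) ((l ^- k.+1)%:E * h (n + k.+1) t).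
  rewrite /Defs.TW integral_nneseries //; congr (limn _); apply/funext => N.
  apply: eq_bigr => k _; rewrite ge0_integralZl // ?addnS // => u _; exact: iter_TW_ge0.
rewrite TWg /g -nneseriesZl; last by move=> k _; exact: term_ge0.
rewrite nneseries_recl //; last first.
  by move=> k _; apply: mule_ge0 => //; rewrite lee_fin ltW.
rewrite addn0 muleA -EFinM expr1 divff ?gt_eqF // mul1e; congr (_ + _).
rewrite -(nneseries_addn 1); last first.
  by move=> k; apply: mule_ge0 => //; rewrite lee_fin ltW.
congr (limn _); apply/funext => N; apply: eq_bigr => k _.
rewrite addn1 muleA -EFinM; congr (_%:E * _).
by rewrite exprS invfM mulrA divff ?gt_eqF // mul1r.
Qed.

(** The Neumann series g at l is also a solution at l', for the right-hand side
    (l' - l) g + h_n, whose mass is at most |l - l'| s + a_n. *)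
Lemma neumann_bound (l' M : R) : (0 <= M)%R ->
  (forall u : T -> R, u \in Lfun mu 1 ->
    \int[mu]_t `|u t|%R%:E <=
    M%:E * \int[mu]_t (`|l' * u t - fine (TW (EFin \o u) t)|)%R%:E) ->
  cvgn (resolvent_series a l n) ->
  (limn (resolvent_series a l n) <=
    M * (a n + `|l - l'| * limn (resolvent_series a l n)))%R.
Proof.
move=> M0 HM cv; set s := limn _.
have intg : mu.-integrable setT (g l n).
  apply/integrableP; split => //.
  under eq_integral do rewrite gee0_abs //.
  by rewrite integral_neumann // ltry.
pose u := fine \o g l n.
have uL : u \in Lfun mu 1 by exact: integrable_fine_Lfun.
have u0 t : (0 <= u t)%R by rewrite fine_ge0.
have intu : \int[mu]_t (u t)%:E = s%:E.
  rewrite -integral_neumann //; apply: ae_eq_integral => //.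
    by apply/measurable_EFinP; exact: measurableT_comp.
  exact: ae_fineK.
have mfu : measurable_fun setT u by exact: measurableT_comp.
have intTu : mu.-integrable setT (TW (EFin \o u)).
  by apply: integrable_TW => //; exact/Lfun1_integrable.
have TWae : ae_eq mu setT (TW (EFin \o u)) (TW (g l n)).
  by case: TW_L1 => + _ _; apply => //; [exact/Lfun1_integrable|exact: ae_fineK].
have mfh : measurable_fun setT (fine \o h n) by exact: measurableT_comp.
have resae : ae_eq mu setT
    (fun t => (`|l' * u t - fine (TW (EFin \o u) t)|)%R%:E)
    (fun t => (`|(l' - l) * u t + fine (h n t)|)%R%:E).
  have finae (f : T -> \bar R) : mu.-integrable setT f ->
    \forall t \ae mu, setT t -> f t \is a fin_num by exact: integrable_ae.
  have hTfin : \forall t \ae mu, h n t \is a fin_num /\ TW (g l n) t \is a fin_num.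
    move: (finae _ (integrable_iter_TW n)) (finae _ (integrable_TW intg)).
    by apply: filterS2 => t /(_ I) ? /(_ I).
  move: TWae (finae _ intg) hTfin.
  apply: filterS3 => t /(_ I) -> /(_ I) gt [ht Tt] _.
  congr ((`| _ |)%R%:E); have := congr1 fine (neumann_resolvent t).
  rewrite fineM // fineD // /= -/(u t) => e.
  have -> : (fine (TW (g l n) t) = l * u t - fine (h n t))%R.
    by rewrite e; ring.
  ring.
have := HM _ uL.
rewrite (_ : \int[mu]_t `|u t|%R%:E = s%:E); last first.
  by rewrite -intu; apply: eq_integral => t _; rewrite ger0_norm.
rewrite (ae_eq_integral _ _ _ _ _ resae) //; last 2 first.
- apply/measurable_EFinP; apply: measurableT_comp => //.
  apply: measurable_funB; first exact: measurable_funM.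
  by apply: measurableT_comp => //; exact: measurable_int intTu.
- apply/measurable_EFinP; apply: measurableT_comp => //.
  by apply: measurable_funD => //; exact: measurable_funM.
have le2 : \int[mu]_t (`|(l' - l) * u t + fine (h n t)|)%R%:E <=
    (`|l - l'| * s + a n)%:E.
  rewrite EFinD EFinM -intu -integral_iter_TW.
  rewrite -ge0_integralZl //; last 2 first.
  - by apply/measurable_EFinP.
  - by move=> t _; rewrite lee_fin.
  rewrite (_ : \int[mu]_t h n t = \int[mu]_t (fine (h n t))%:E); last first.
    apply: ae_eq_integral => //; first exact/measurable_EFinP.
    by apply: ae_eq_sym; apply: ae_fineK; exact: integrable_iter_TW.
  rewrite -ge0_integralD //; last 4 first.
  - by move=> t _; rewrite -EFinM lee_fin mulr_ge0.
  - by apply: measurable_funeM; exact/measurable_EFinP.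
  - by move=> t _; rewrite lee_fin fine_ge0 // iter_TW_ge0.
  - exact/measurable_EFinP.
  apply: ge0_le_integral => //.
  - apply/measurable_EFinP; apply: measurableT_comp => //.
    by apply: measurable_funD => //; exact: measurable_funM.
  - by apply: emeasurable_funD; [apply: measurable_funeM|]; exact/measurable_EFinP.
  move=> t _; rewrite -EFinM -EFinD lee_fin (le_trans (ler_normD _ _)) //.
  by rewrite normrM (ger0_norm (u0 t)) distrC (ger0_norm (fine_ge0 (iter_TW_ge0 n t))).
move=> /le_trans /(_ (lee_wpmul2l _ le2)).
rewrite lee_fin => /(_ M0); rewrite -EFinM lee_fin addrC //.
Qed.

End resolvent.

(** A spectral radius below 1 puts [1, +oo[ in the resolvent set, which by
    positivity is all that [cvg0_of_resolvent_bounds] requires. *)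
Lemma cvg0_integral_iter_TW : spectral_radius mu Q < 1 ->
  fine (\int[mu]_t h k t) @[k --> \oo] --> 0%R.
Proof.
move=> rad; case: (TW_L1) => _ _ [M0 HM0].
apply: (@cvg0_of_resolvent_bounds _ a M0) => //.
- move=> n; have [_] := HM0 _ (integrable_iter_TW n).
  have absh k : \int[mu]_t `|h k t| = (a k)%:E.
    by rewrite -integral_iter_TW; apply: eq_integral => t _; rewrite gee0_abs ?iter_TW_ge0.
  by rewrite absh (absh n.+1) -EFinM lee_fin.
- move=> l l1; have [|M M_ge0 HM] := @L1_resolvent_bound l.
    apply: (resolvent_set_gt_radius rad); rewrite Re_normC /= expr0n addr0 sqrtr_sqr.
    by rewrite ger0_norm // (le_trans ler01).
  exists M => l' n l'1 cv; apply: neumann_bound => //; exact: lt_le_trans l'1.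
Qed.

End nonneg.

End L1_decay.

(** * Measurability on the space of trees *)

Section weights.
Context {T : Type} {R : realType}.
Implicit Types x : mtree T R.

Definition deg_is n : set (mtree T R) := [set x | deg x [::] = n].
Definition has_child i : set (mtree T R) := [set x | (i < deg x [::])%N].

Lemma has_childE i : has_child i = \bigcup_(n in [set n | (i < n)%N]) deg_is n.
Proof.
apply/seteqP; split => [x ix|x [n /= n_i xn]]; last by rewrite /has_child /= xn.
by exists (deg x [::]).
Qed.

Lemma edge_root x i : edge x [::] [:: i] <-> (i < deg x [::])%N.
Proof.
split=> [[_ /mapP[j]]|ix]; first by rewrite mem_iota /= add0n => jx [->].
by split => //; apply/mapP; exists i; rewrite ?mem_iota.
Qed.

Lemma sum_children x (y : word -> R) :
  \sum_(u <- children x [::]) y u = \sum_(0 <= i < deg x [::]) y [:: i].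
Proof. by rewrite /children big_map /index_iota subn0. Qed.

Lemma weight_root x i : (i < deg x [::])%N -> weight x [::] [:: i] =
  (expo x [::] [:: i])%:num /
  \sum_(0 <= j < deg x [::]) (expo x [::] [:: j])%:num.
Proof.
move=> ix; rewrite /weight asboolT; last exact/edge_root.
by rewrite -(sum_children x (fun u => (expo x [::] u)%:num)).
Qed.

Lemma weight_ge0 x v u : 0 <= weight x v u.
Proof.
by rewrite /weight; case: ifP => // _; rewrite divr_ge0 // sumr_ge0.
Qed.

End weights.

Section tree_measurability.
Context d (T : measurableType d) (R : realType).
Notation tree := (mtree T R).
Notation deg_is := (@deg_is T R).
Notation has_child := (@has_child T R).

(** Trees with the sigma-algebra on which the branching property at the root
    conditions; the weights of the root have to be measurable for it, and not
    only for the full sigma-algebra, to be taken out of the conditioning. *)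
Definition startree := g_sigma_algebraType (@star_events d T R [::]).

Lemma measurable_star (E : set startree) : measurable E -> measurable (E : set tree).
Proof.
apply: (smallest_sub (@sigma_algebra_measurable _ _)) => F.
move=> [[[|]|[i _]]|] FE; apply: sub_sigma_algebra.
- by exists [::] => //; left; left; left.
- by exists [::] => //; left; left; right.
- by exists (rcons [::] i) => //; left; left; right.
- by exists [::] => //; right.
Qed.

Lemma measurable_star_deg_is n : measurable (deg_is n : set startree).
Proof.
apply: sub_sigma_algebra; left; left; left; exists n.
by apply/seteqP; split => [x|x []].
Qed.

Lemma measurable_deg_is n : measurable (deg_is n).
Proof. by apply: measurable_star; exact: measurable_star_deg_is. Qed.

Lemma measurable_has_child i : measurable (has_child i).
Proof.
by rewrite has_childE; apply: bigcup_measurable => n _; exact: measurable_deg_is.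
Qed.

Lemma measurable_star_root_typ (A : set T) : measurable A ->
  measurable (root_typ @^-1` A : set startree).
Proof.
move=> mA; apply: sub_sigma_algebra; left; left; right; exists A => //.
by apply/seteqP; split => [x|x []].
Qed.

Lemma measurable_star_expo i n : (i < n)%N ->
  measurable_fun (deg_is n : set startree)
    (fun x => (expo x [::] [:: i])%:num : R).
Proof.
move=> i_n _ A mA.
have -> : (deg_is n `&` (fun x => (expo x [::] [:: i])%:num : R) @^-1` A) =
    deg_is n `&` [set x : tree | edge x [::] [:: i] /\ A (expo x [::] [:: i])%:num].
  apply/seteqP; split => x [/= xn]; last by move=> [].
  by move=> Ax; do 2 split => //; apply/edge_root; rewrite xn.
apply: measurableI; first exact: measurable_star_deg_is.
by apply: sub_sigma_algebra; right; exists [:: i]; exists A.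
Qed.

Lemma measurable_star_weight i n : (i < n)%N ->
  measurable_fun (deg_is n : set startree) (fun x => weight x [::] [:: i] : R).
Proof.
move=> i_n.
(* Real powers are measurable, and the power -1 is the inverse on x >= 0. *)
apply: (eq_measurable_fun (fun x : startree => (expo x [::] [:: i])%:num *
    (\sum_(j < n) (expo x [::] [:: nat_of_ord j])%:num) `^ (-1))).
  move=> x; rewrite inE /deg_is /= => xn.
  rewrite weight_root ?xn // powR_inv1 ?sumr_ge0 // big_mkord //.
apply: measurable_funM; first exact: measurable_star_expo.
apply: (measurableT_comp (measurable_powR _)).
by apply: measurable_sum => j; exact: measurable_star_expo.
Qed.

Lemma measurable_fun_star d' (U : measurableType d') (D : set startree)
    (f : startree -> U) : measurable D -> measurable_fun D f ->
  measurable_fun (D : set tree) (f : tree -> U).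
Proof. by move=> mD mf _ A mA; apply: measurable_star; exact: mf. Qed.

End tree_measurability.

Section netinput.
Context d (T : measurableType d) (R : realType).
Notation tree := (mtree T R).
Notation deg_is := (@deg_is T R).
Notation has_child := (@has_child T R).

Definition netinput (x : tree) (y : nat -> R) : R :=
  \sum_(0 <= i < deg x [::]) weight x [::] [:: i] * y i.

Lemma deg_is_has_child i n : (i < n)%N -> deg_is n `<=` has_child i.
Proof. by move=> i_n x xn; rewrite /has_child /= xn. Qed.

Lemma bigcup_deg_is : \bigcup_n deg_is n = setT.
Proof. by apply/seteqP; split => // x _; exists (deg x [::]). Qed.

Lemma measurable_fun_by_deg d' (U : measurableType d') (f : tree -> U) :
  (forall n, measurable_fun (deg_is n) f) -> measurable_fun setT f.
Proof.
move=> mf; rewrite -bigcup_deg_is; apply/measurable_fun_bigcup => // n.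
exact: measurable_deg_is.
Qed.

Lemma measurable_weight i n : (i < n)%N ->
  measurable_fun (deg_is n) (fun x : tree => weight x [::] [:: i] : R).
Proof.
move=> i_n; apply: measurable_fun_star; first exact: measurable_star_deg_is.
exact: measurable_star_weight.
Qed.

Lemma measurable_netinput (g : nat -> tree -> R) :
  (forall i, measurable_fun (has_child i) (g i)) ->
  measurable_fun setT (fun x => netinput x (g ^~ x)).
Proof.
move=> mg; apply: measurable_fun_by_deg => n.
apply: (eq_measurable_fun (fun x : tree =>
    \sum_(i < n) weight x [::] [:: nat_of_ord i] * g i x)).
  by move=> x; rewrite inE /netinput => <-; rewrite big_mkord.
apply: measurable_sum => i; apply: measurable_funM; first exact: measurable_weight.
apply: (measurable_funS _ (deg_is_has_child (ltn_ord i))) => //.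
exact: measurable_has_child.
Qed.

Definition child (x : tree) i := subtree x [:: i].

Lemma vertices_child (x : tree) i v : vertices x (i :: v) <->
  has_child i x /\ vertices (child x i) v.
Proof.
split=> [xv|[ix xv] [|k] kv]; last 2 first.
- exact: ix.
- exact: xv.
split; first exact: (xv 0%N).
by move=> k kv; exact: (xv k.+1).
Qed.

Lemma children_child (x : tree) i v :
  children x (i :: v) = map (cons i) (children (child x i) v).
Proof. by rewrite /children -map_comp. Qed.

Lemma edge_child (x : tree) i v u : has_child i x ->
  edge x (i :: v) (i :: u) <-> edge (child x i) v u.
Proof.
move=> ix; rewrite /edge children_child mem_map; last by move=> ? ? [].
by split=> -[xv xu]; split => //; [case/vertices_child: xv|apply/vertices_child].
Qed.


Lemma weight_child (x : tree) i v u : has_child i x ->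
  weight x (i :: v) (i :: u) = weight (child x i) v u.
Proof.
move=> ix; rewrite /weight.
rewrite (_ : `[< edge x (i :: v) (i :: u) >] = `[< edge (child x i) v u >]); last first.
  exact/asbool_equiv_eq/edge_child.
by rewrite children_child big_map.
Qed.

Lemma measurable_child i : measurable_fun (has_child i) (child ^~ i).
Proof.
apply: (measurability (@tree_events d T R)) => //.
move=> _ [F [v _ Fv] <-].
have mi := @measurable_has_child d T R i.
have vch v' (Z : set tree) :
    has_child i `&` (child ^~ i) @^-1` ([set x | vertices x v'] `&` Z) =
    [set x | vertices x (i :: v')] `&` (child ^~ i) @^-1` Z.
  apply/seteqP; split => x /= [].
    by move=> ix [xv xZ]; split => //; apply/vertices_child.
  by move=> /vertices_child[].
case: Fv => [[[[n ->]|[A mA ->]]|[A mA ->]]|[u [A mA ->]]].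
- rewrite (vch v [set x | deg x v = n]).
  by apply: sub_sigma_algebra; exists (i :: v) => //; left; left; left; exists n.
- rewrite (vch v [set x | A (typ x v)]).
  by apply: sub_sigma_algebra; exists (i :: v) => //; left; left; right; exists A.
- rewrite (vch v [set x | A (shock x v)]).
  by apply: sub_sigma_algebra; exists (i :: v) => //; left; right; exists A.
- rewrite [X in measurable X](_ : _ =
      [set x | edge x (i :: v) (i :: u) /\ A (expo x (i :: v) (i :: u))%:num]).
    apply: sub_sigma_algebra; exists (i :: v) => //; right.
    by exists (i :: u); exists A.
  apply/seteqP; split => x /= [].
    by move=> ix [xv xA]; split => //; apply/edge_child.
  move=> xvu xA; have ix : has_child i x by case: xvu => /vertices_child[].
  by split => //; split => //; apply/edge_child.
Qed.

Lemma measurable_netinput_child (F : tree -> R) : measurable_fun setT F ->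
  measurable_fun setT (fun x => netinput x (fun i => F (child x i))).
Proof.
move=> mF; apply: (@measurable_netinput (fun i x => F (child x i))) => i.
by apply: (measurableT_comp mF); exact: measurable_child.
Qed.

Lemma measurable_shock_root : measurable_fun setT (fun x : tree => shock x [::]).
Proof.
move=> _ A mA; rewrite setTI; apply: sub_sigma_algebra.
exists [::] => //; left; right; exists A => //.
by apply/seteqP; split => [x Ax|x []//].
Qed.

(** The iterates at a descendant of a child only see the subtree at that child,
    so that they can be computed there; y0 is the starting value as a function of
    the response, 0 or its supremum. *)
Lemma iter_update_child (phi : T -> R -> R) (y0 : (R -> R) -> R) k x i v :
  has_child i x ->
  iter k (update x (fun u => phi (typ x u))) (fun u => y0 (phi (typ x u))) (i :: v) =
  iter k (update (child x i) (fun u => phi (typ (child x i) u)))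
    (fun u => y0 (phi (typ (child x i) u))) v.
Proof.
move=> ix; elim: k v => //= k ih v; rewrite /update children_child big_map.
congr (phi _ (_ + _)); apply: eq_bigr => u _.
by rewrite weight_child // ih.
Qed.

(** Together with the branching property, this form of the recursion is what
    allows inductions on k over all trees that never leave the root. *)
Lemma iter_update_root (phi : T -> R -> R) (y0 : (R -> R) -> R) k x :
  iter k.+1 (update x (fun u => phi (typ x u))) (fun u => y0 (phi (typ x u))) [::] =
  phi (root_typ x) (netinput x (fun i =>
    iter k (update (child x i) (fun u => phi (typ (child x i) u)))
      (fun u => y0 (phi (typ (child x i) u))) [::]) + shock x [::]).
Proof.
rewrite /= {1}/update; congr (phi _ (_ + _)).
rewrite (sum_children x (fun u => weight x [::] u * _ u)) /netinput.
apply: eq_big_nat => i /andP[_ ix]; congr (_ * _).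
exact: iter_update_child.
Qed.

End netinput.

(** * Many-to-one formula *)

Section offspring.
Context d (T : measurableType d) (R : realType).
Notation tree := (mtree T R).
Context dY (Y : measurableType dY).
Local Open Scope ereal_scope.

Definition offspring (x : tree) (m : nat -> {measure set Y -> \bar R}) :
  {measure set Y -> \bar R} :=
  msum (fun i => mscale (NngNum (weight_ge0 x [::] [:: i])) (m i)) (deg x [::]).

Lemma offspringE x m A : offspring x m A =
  \sum_(0 <= i < deg x [::]) (weight x [::] [:: i])%:E * m i A.
Proof. by rewrite /offspring /= /msum big_mkord. Qed.

Lemma integral_offspring x m (h : Y -> \bar R) :
  measurable_fun setT h -> (forall y, 0 <= h y) ->
  \int[offspring x m]_y h y =
  \sum_(0 <= i < deg x [::]) (weight x [::] [:: i])%:E * \int[m i]_y h y.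
Proof.
move=> mh h0; rewrite /offspring ge0_integral_measure_sum // big_mkord.
by apply: eq_bigr => i _; rewrite ge0_integral_mscale.
Qed.

Lemma netinput_EFin (x : tree) (y : nat -> R) : (netinput x y)%:E =
  \sum_(0 <= i < deg x [::]) (weight x [::] [:: i])%:E * (y i)%:E.
Proof. by rewrite /netinput -sumEFin. Qed.

End offspring.

Lemma integral_diracT d (T : measurableType d) (R : realType) (a : T)
    (h : T -> \bar R) :
  measurable_fun setT h -> (\int[\d_a]_t h t = h a)%E.
Proof. by move=> mh; rewrite integral_dirac // diracT mul1e. Qed.

Section many_to_one.
Context dO d (Omega : measurableType dO) (T : measurableType d) (R : realType).
Notation tree := (mtree T R).
Notation deg_is := (@deg_is T R).
Notation has_child := (@has_child T R).
Variables (P : probability Omega R) (G : {RV P >-> tree}).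
Variable K : R.-pker T ~> tree.
Hypothesis K_law : type_conditioned_law G K.
Hypothesis G_branching : branching G K.
Local Open Scope ereal_scope.

Let mu := root_law G.

Let rooted (A : set T) : set Omega := G @^-1` (@root_typ T R @^-1` A).

Let mG (S : set tree) : measurable S -> measurable (G @^-1` S).
Proof. by move=> mS; exact: measurable_funPTI. Qed.

Let measurable_root (A : set T) : measurable A -> measurable (@root_typ T R @^-1` A).
Proof. by move=> mA; exact: measurable_funPTI. Qed.

Let mrooted A : measurable A -> measurable (rooted A).
Proof. by move=> mA; apply: mG; exact: measurable_root. Qed.

Lemma disintegration (A : set T) (F : tree -> \bar R) :
  measurable A -> measurable_fun setT F -> (forall x, 0 <= F x) ->
  \int[P]_(w in rooted A) F (G w) = \int[mu]_(t in A) \int[K t]_x F x.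
Proof.
move=> mA mF F0.
under eq_integral do rewrite -(integral_diracT _ mF).
apply: eq_integral_mixture => //; first exact: mrooted.
- move=> S mS; apply: measurable_funTS.
  apply: (measurableT_comp (f := fun x : tree => \d_x S)) => //.
  exact: measurable_fun_dirac.
- by move=> S mS; apply: measurable_funTS; exact: measurable_kernel.
move=> S mS; rewrite -K_law //.
rewrite (_ : G @^-1` _ = rooted A `&` G @^-1` S) //.
rewrite setIC -(integral_indic P (mrooted mA) (mG mS)).
by apply: eq_integral.
Qed.

(** The product over the children collapses: the events at the other children are
    taken to be sure. *)
Lemma branching_child n i (E S : set tree) : (i < n)%N ->
  measurable (E : set (startree T R)) -> measurable S ->
  P (G @^-1` (E `&` deg_is n `&` [set x | S (child x i)])) =
  \int[P]_(w in G @^-1` (E `&` deg_is n)) K (typ (G w) [:: i]) S.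
Proof.
move=> i_n mE mS.
pose Si (j : nat) : set tree := if j == i then S else setT.
have mSi j : measurable (Si j) by rewrite /Si; case: ifP.
have E'E : E `&` [set x | vertices x [::] /\ deg x [::] = n] = E `&` deg_is n.
  by apply/seteqP; split => x [Ex] => [[]|].
have := @G_branching [::] n E Si mE mSi; rewrite /= E'E => e.
rewrite (_ : G @^-1` _ = G @^-1` (E `&` deg_is n `&`
    [set x | forall j, (j < n)%N -> Si j (subtree x (rcons [::] j))])); last first.
  congr (_ @^-1` _); apply/seteqP; split => x [xE xS]; split => //.
    by move=> j _; rewrite /Si; case: eqP => // ->.
  by have := xS i i_n; rewrite /Si eqxx.
rewrite e; apply: eq_integral => w _.
rewrite (bigD1 (Ordinal i_n)) //= big1 ?mulr1; last first.
  move=> j /negbTE ji; rewrite /Si; case: eqP => [ij|_]; last by rewrite prob_kernel.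
  by move: ji; rewrite -val_eqE /= ij eqxx.
by rewrite /Si eqxx fineK // finite_kernel_measure.
Qed.

Lemma measurable_comp_rooted d' (U : measurableType d') n (A : set T) (g : tree -> U) :
  measurable A -> measurable_fun (deg_is n) g ->
  measurable_fun (rooted A `&` G @^-1` deg_is n) (g \o G).
Proof.
move=> mA mg; apply: (measurable_comp (F := deg_is n)) => //.
- exact: measurable_deg_is.
- by move=> _ [w [_ wn] <-].
- exact: measurable_funTS.
Qed.

Lemma measurable_fun_deg_is d' (U : measurableType d') i n (g : tree -> U) :
  (i < n)%N -> measurable_fun (has_child i) g -> measurable_fun (deg_is n) g.
Proof.
move=> i_n; apply: measurable_funS; first exact: measurable_has_child.
exact: deg_is_has_child.
Qed.

Lemma measurable_kernel_typ i (S : set tree) : measurable S ->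
  measurable_fun (has_child i) (fun x : tree => K (typ x [:: i]) S).
Proof.
move=> mS; apply: (measurableT_comp (measurable_kernel K S mS)).
rewrite (_ : (fun x => typ x [:: i]) = @root_typ T R \o (fun x => child x i)) //.
by apply: (measurableT_comp (f := @root_typ T R)) => //; exact: measurable_child.
Qed.

(** The weight of the i-th child depends only on the star of the root.  With S
    fixed, both sides integrate it against a measure on the events of the star,
    and the two measures agree by [branching_child]. *)
Lemma branching_weight n i (A : set T) (S : set tree) : (i < n)%N ->
  measurable A -> measurable S ->
  \int[P]_(w in rooted A `&` G @^-1` deg_is n)
    (weight (G w) [::] [:: i] * \1_S (child (G w) i))%:E =
  \int[P]_(w in rooted A `&` G @^-1` deg_is n)
    (weight (G w) [::] [:: i] * fine (K (typ (G w) [:: i]) S))%:E.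
Proof.
move=> i_n mA mS.
have mdeg : measurable (deg_is n) := measurable_deg_is n.
pose D := rooted A `&` G @^-1` deg_is n; have mD : measurable D.
  by apply: measurableI; [exact: mrooted|exact: mG].
pose phi : startree T R -> \bar R :=
  (fun x : tree => (weight x [::] [:: i])%:E) \_ (deg_is n).
have mphi : measurable_fun setT phi.
  apply/(measurable_restrictT _ (measurable_star_deg_is n)).
  by apply/measurable_EFinP; exact: measurable_star_weight.
have phi0 x : 0 <= phi x.
  by rewrite /phi patchE; case: ifP => // _; rewrite lee_fin weight_ge0.
have indic_ge0 x : (0 <= \1_S x :> R)%R by rewrite indicE.
pose k1 (w : Omega) : {measure set (startree T R) -> \bar R} :=
  mscale (NngNum (indic_ge0 (child (G w) i))) (\d_(G w : startree T R)).
pose k2 (w : Omega) : {measure set (startree T R) -> \bar R} :=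
  mscale (NngNum (fine_ge0 (measure_ge0 (K (typ (G w) [:: i])) S)))
    (\d_(G w : startree T R)).
have int_scale (r : {nonneg R}) x : deg_is n x ->
    \int[mscale r (\d_(x : startree T R))]_y phi y =
    (weight x [::] [:: i] * r%:num)%:E.
  move=> xn; rewrite ge0_integral_mscale // integral_diracT //.
  by rewrite /phi patchE mem_set // -EFinM mulrC.
transitivity (\int[P]_(w in rooted A `&` G @^-1` deg_is n) \int[k1 w]_y phi y).
  by apply: eq_integral => w; rewrite inE => -[_ wn]; rewrite int_scale.
transitivity (\int[P]_(w in rooted A `&` G @^-1` deg_is n) \int[k2 w]_y phi y);
  last first.
  by apply: eq_integral => w; rewrite inE => -[_ wn]; rewrite int_scale.
have k1E w (E : set (startree T R)) :
  k1 w E = (\1_S (child (G w) i))%:E * \d_(G w : startree T R) E by [].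
have k2E w (E : set (startree T R)) :
  k2 w E = (fine (K (typ (G w) [:: i]) S))%:E * \d_(G w : startree T R) E by [].
have mK : measurable_fun D (fun w => K (typ (G w) [:: i]) S) :=
  measurable_comp_rooted mA (measurable_fun_deg_is i_n (@measurable_kernel_typ i _ mS)).
have mchild : measurable_fun D (fun w => child (G w) i) :=
  measurable_comp_rooted mA (measurable_fun_deg_is i_n (@measurable_child d T R i)).
have mchildS : measurable (D `&` (fun w => child (G w) i) @^-1` S).
  exact: mchild.
have mdirac (E : set (startree T R)) : measurable E ->
    measurable_fun D (fun w => \d_(G w : startree T R) E : \bar R).
  move=> mE; apply: measurable_funTS.
  apply: (measurableT_comp (f := fun x : tree => \d_x (E : set tree))) => //.
  by apply: measurable_fun_dirac; exact: measurable_star.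
have DE (E : set (startree T R)) : D `&` G @^-1` E =
    G @^-1` ((E `&` @root_typ T R @^-1` A) `&` deg_is n).
  by apply/seteqP; split => w /= [[? ?] ?].
apply: eq_integral_mixture => //.
- move=> E mE; under eq_fun do rewrite k1E; apply: emeasurable_funM; last exact: mdirac.
  apply/measurable_EFinP.
  rewrite (_ : (fun w => _) = \1_S \o (fun w => child (G w) i)) //.
  by apply: (measurableT_comp (measurable_indic _)).
- move=> E mE; under eq_fun do rewrite k2E; apply: emeasurable_funM; last exact: mdirac.
  by apply/measurable_EFinP; apply: measurableT_comp.
move=> E mE.
have -> : \int[P]_(w in D) k1 w E = P (G @^-1` ((E `&` @root_typ T R @^-1` A)
    `&` deg_is n `&` [set x | S (child x i)])).
  transitivity (P ((D `&` (fun w => child (G w) i) @^-1` S `&` G @^-1` E) `&` D)).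
    have mB := measurableI _ _ mchildS (mG (measurable_star mE)).
    rewrite -(integral_indic P mD mB).
    apply: eq_integral => w; rewrite inE => wD.
    rewrite k1E diracE -EFinM !indicE -natrM.
    by rewrite mulnb 2!in_setI (mem_set wD).
  congr (P _); apply/seteqP.
  by split => w /=; rewrite /D /rooted /preimage /=; tauto.
rewrite branching_child //; last first.
  by apply: measurableI => //; exact: measurable_star_root_typ.
rewrite -DE (integral_mkcondr P D); apply: eq_integral => w _.
rewrite k2E fineK ?finite_kernel_measure // patchE diracE.
rewrite (_ : (w \in G @^-1` E) = (G w \in E)) //.
by case: (_ \in _); rewrite ?mule1 ?mule0.
Qed.

Lemma measurable_netinput_rv (g : nat -> tree -> R) :
  (forall i, measurable_fun (has_child i) (g i)) ->
  measurable_fun setT (fun w => netinput (G w) (g ^~ (G w))).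
Proof.
move=> mg; apply: (measurableT_comp (f := fun x : tree => netinput x (g ^~ x))) => //.
exact: measurable_netinput.
Qed.

Lemma measurable_fine_kernel_typ i (S : set tree) : measurable S ->
  measurable_fun (has_child i) (fun x : tree => fine (K (typ x [:: i]) S)).
Proof. by move=> mS; apply: measurableT_comp => //; exact: measurable_kernel_typ. Qed.

Lemma measurable_indic_child i (S : set tree) : measurable S ->
  measurable_fun (has_child i) (fun x : tree => \1_S (child x i) : R).
Proof.
move=> mS; rewrite (_ : (fun x => _) = \1_S \o (fun x => child x i)) //.
by apply: measurableT_comp; [exact: measurable_indic|exact: measurable_child].
Qed.

Lemma netinput_ge0 (x : tree) (y : nat -> R) : (forall i, 0 <= y i)%R ->
  (0 <= netinput x y)%R.
Proof. by move=> y0; apply: sumr_ge0 => i _; rewrite mulr_ge0 // weight_ge0. Qed.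

(** The out-degree belongs to the star, so the identity is split according to its
    value; only then are the children a fixed number. *)
Lemma branching_netinput (A : set T) (S : set tree) :
  measurable A -> measurable S ->
  \int[P]_(w in rooted A) (netinput (G w) (fun i => \1_S (child (G w) i)))%:E =
  \int[P]_(w in rooted A)
    (netinput (G w) (fun i => fine (K (typ (G w) [:: i]) S)))%:E.
Proof.
move=> mA mS.
pose D n := rooted A `&` G @^-1` deg_is n.
have mD n : measurable (D n).
  by apply: measurableI; [exact: mrooted|apply: mG; exact: measurable_deg_is].
have DE : rooted A = \bigcup_n D n.
  by apply/seteqP; split => [w Aw|w [n _ []] //]; exists (deg (G w) [::]).
have tD : trivIset setT D by move=> i j _ _ [w [[_ <-] [_ <-]]].
have split_deg (g : nat -> tree -> R) : (forall i x, 0 <= g i x)%R ->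
    (forall i, measurable_fun (has_child i) (g i)) ->
    \int[P]_(w in rooted A) (netinput (G w) (g ^~ (G w)))%:E =
    \sum_(n <oo) \sum_(i < n) \int[P]_(w in D n)
      (weight (G w) [::] [:: nat_of_ord i] * g i (G w))%:E.
  move=> g0 mg; rewrite DE ge0_integral_bigcup //; last 2 first.
  - by apply: measurable_funTS; apply/measurable_EFinP; exact: measurable_netinput_rv.
  - by move=> w _; rewrite lee_fin netinput_ge0.
  apply: eq_eseriesr => n _; rewrite -ge0_integral_sum //; last 2 first.
  - move=> i; apply/measurable_EFinP.
    apply: (measurable_comp_rooted mA
      (g := fun x => weight x [::] [:: nat_of_ord i] * g i x)%R).
    apply: measurable_funM; first exact: measurable_weight.
    exact: measurable_fun_deg_is (ltn_ord i) (mg i).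
  - by move=> i w _; rewrite lee_fin mulr_ge0 // weight_ge0.
  apply: eq_integral => w; rewrite inE => -[_ <-].
  by rewrite sumEFin /netinput big_mkord.
rewrite (split_deg (fun i x => \1_S (child x i))); last 2 first.
- by move=> i x; rewrite indicE.
- by move=> i; exact: measurable_indic_child.
rewrite (split_deg (fun i x => fine (K (typ x [:: i]) S))); last 2 first.
- by move=> i x; rewrite fine_ge0.
- by move=> i; exact: measurable_fine_kernel_typ.
apply: eq_eseriesr => n _; apply: eq_bigr => i _.
exact: branching_weight.
Qed.

Lemma integral_netinput_child (A : set T) (F : tree -> \bar R) :
  measurable A -> measurable_fun setT F -> (forall x, 0 <= F x) ->
  \int[P]_(w in rooted A) \sum_(0 <= i < deg (G w) [::])
    (weight (G w) [::] [:: i])%:E * F (child (G w) i) =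
  \int[P]_(w in rooted A) \sum_(0 <= i < deg (G w) [::])
    (weight (G w) [::] [:: i])%:E * \int[K (typ (G w) [:: i])]_x F x.
Proof.
move=> mA mF F0.
pose k1 w := offspring (G w) (fun i => \d_(child (G w) i)).
pose k2 w := offspring (G w) (fun i => K (typ (G w) [:: i])).
have k1E w S : k1 w S = (netinput (G w) (fun i => \1_S (child (G w) i)))%:E.
  by rewrite offspringE netinput_EFin.
have k2E w S : measurable S ->
    k2 w S = (netinput (G w) (fun i => fine (K (typ (G w) [:: i]) S)))%:E.
  move=> mS; rewrite offspringE netinput_EFin; apply: eq_bigr => i _.
  by rewrite fineK // finite_kernel_measure.
transitivity (\int[P]_(w in rooted A) \int[k1 w]_x F x).
  apply: eq_integral => w _; rewrite integral_offspring //.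
  by apply: eq_bigr => i _; rewrite integral_diracT.
transitivity (\int[P]_(w in rooted A) \int[k2 w]_x F x); last first.
  by apply: eq_integral => w _; rewrite integral_offspring.
apply: eq_integral_mixture => //; try exact: mrooted.
- move=> S mS; under eq_fun do rewrite k1E.
  apply: measurable_funTS; apply/measurable_EFinP.
  apply: (measurable_netinput_rv (g := fun i x => \1_S (child x i))) => i.
  exact: measurable_indic_child.
- move=> S mS; under eq_fun do rewrite k2E //.
  apply: measurable_funTS; apply/measurable_EFinP.
  apply: (measurable_netinput_rv (g := fun i x => fine (K (typ x [:: i]) S))) => i.
  exact: measurable_fine_kernel_typ.
- move=> S mS; under eq_integral do rewrite k1E.
  by under [RHS]eq_integral do rewrite k2E //; exact: branching_netinput.
Qed.

Variable Q : R.-ker T ~> T.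
Hypothesis Q_QW : is_QW G Q.
Local Notation TW := (@TW d T R Q).

Lemma integral_netinput_typ (A : set T) (h : T -> \bar R) :
  measurable A -> measurable_fun setT h -> (forall t, 0 <= h t) ->
  \int[P]_(w in rooted A) \sum_(0 <= i < deg (G w) [::])
    (weight (G w) [::] [:: i])%:E * h (typ (G w) [:: i]) =
  \int[mu]_(t in A) TW h t.
Proof.
move=> mA mh h0.
pose k w := offspring (G w) (fun i => \d_(typ (G w) [:: i])).
have kE w B : k w B = (netinput (G w) (fun i => \1_B (typ (G w) [:: i])))%:E.
  by rewrite offspringE netinput_EFin.
transitivity (\int[P]_(w in rooted A) \int[k w]_t h t).
  apply: eq_integral => w _; rewrite integral_offspring //.
  by apply: eq_bigr => i _; rewrite integral_diracT.
apply: eq_integral_mixture => //; try exact: mrooted.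
- move=> B mB; under eq_fun do rewrite kE.
  apply: measurable_funTS; apply/measurable_EFinP.
  apply: (measurable_netinput_rv (g := fun i x => \1_B (typ x [:: i]))) => i.
  exact: (@measurable_indic_child i _ (measurable_root mB)).
- by move=> B mB; apply: measurable_funTS; exact: measurable_kernel.
- move=> B mB; rewrite Q_QW //; apply: eq_integral => w _; rewrite kE.
  by rewrite (sum_children (G w) (fun u => weight (G w) [::] u * \1_B (typ (G w) u)))%R.
Qed.

Section many_to_one_iterates.
Hypothesis TW_L1 : TW_bounded_positive_on_L1 mu Q.
Variable B : T -> R.
Hypothesis B_ge0 : forall t, (0 <= B t)%R.
Hypothesis B_L1 : B \in Lfun mu 1.

(** Iterated from the root value B, this is the sum of B over a generation, each
    vertex counted with the product of the weights leading to it. *)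
Definition propagate (F : tree -> R) : tree -> R :=
  fun x => netinput x (fun i => F (child x i)).

Let S k : tree -> R := iter k propagate (B \o @root_typ T R).
Let h k : T -> \bar R := iter k TW (EFin \o B).

Let mB : measurable_fun setT B.
Proof. by move: B_L1 => /sub_Lfun_mfun; rewrite inE. Qed.

Let S_ge0 k x : (0 <= S k x)%R.
Proof.
elim: k x => [|k ih] x; first exact: B_ge0.
by apply: netinput_ge0 => i; exact: ih.
Qed.

Let mS k : measurable_fun setT (S k).
Proof.
elim: k => [|k ih]; first exact: (measurableT_comp mB).
exact: measurable_netinput_child.
Qed.

Let h_ge0 k t : 0 <= h k t.
Proof. by apply: iter_TW_ge0 => u; rewrite lee_fin. Qed.

Let h_int k : mu.-integrable setT (h k).
Proof. by apply: integrable_iter_TW => //; exact/Lfun1_integrable. Qed.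

Let EFin_S_ge0 k x : 0 <= (S k x)%:E.
Proof. by rewrite lee_fin. Qed.

Let mES k : measurable_fun setT (fun x => (S k x)%:E).
Proof. exact/measurable_EFinP. Qed.

(** E[S_k | root type] = T_W^k B, stated on events of the root type.  In the
    induction, KS is the conditional mean of S_k as given by the law K.  It is
    known to coincide with T_W^k B only almost everywhere, and it is the
    compatibility of T_W with equality almost everywhere that lets the next T_W
    be applied. *)
Lemma integral_propagate k (A : set T) : measurable A ->
  \int[P]_(w in rooted A) (S k (G w))%:E = \int[mu]_(t in A) h k t.
Proof.
elim: k A => [|k ih] A mA.
  rewrite /mu /root_law /= ge0_integral_pushforward //=.
  - by apply: measurable_funTS; exact/measurable_EFinP.
  - by move=> t _; rewrite lee_fin.
pose KS t := \int[K t]_x (S k x)%:E.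
have mKS : measurable_fun setT KS.
  by apply: measurable_fun_integral_kernel => // U; exact: measurable_kernel.
have KS_ge0 t : 0 <= KS t by apply: integral_ge0 => x _.
have KSh : ae_eq mu setT (h k) KS.
  apply: integral_ae_eq => // E _ mE.
  by rewrite -ih // (disintegration mE (mES k)).
have KS_int : mu.-integrable setT KS.
  apply/integrableP; split => //; have /integrableP[_] := h_int k.
  under eq_integral do rewrite gee0_abs //.
  under [in X in _ -> X]eq_integral do rewrite gee0_abs //.
  rewrite (ge0_ae_eq_integral measurableT _ mKS _ _ KSh) //.
  exact: measurable_int (h_int k).
have TWae : ae_eq mu setT (TW (h k)) (TW KS) by case: TW_L1 => + _ _; apply.
transitivity (\int[mu]_(t in A) TW KS t); last first.
  apply: ge0_ae_eq_integral => //.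
  - by apply: measurable_funTS; exact: measurable_TW.
  - by apply: measurable_funTS; exact: measurable_int (h_int k.+1).
  - by move=> t _; apply: integral_ge0.
  - by apply: ae_eq_sym; apply: (ae_eq_subset (@subsetT _ A)).
rewrite -integral_netinput_typ // -(integral_netinput_child mA (mES k) (EFin_S_ge0 k)).
by apply: eq_integral => w _; rewrite -netinput_EFin.
Qed.

Lemma cvg0_expectation_propagate : spectral_radius mu Q < 1 ->
  \int[P]_w (S k (G w))%:E @[k --> \oo] --> 0.
Proof.
move=> rad.
have SE k : \int[P]_w (S k (G w))%:E = \int[mu]_t h k t.
  by rewrite -integral_propagate //; congr integral; apply/seteqP.
under eq_fun do rewrite SE.
apply: cvg_EFin.
  by apply: nearW => k; apply: integrable_fin_num => //; exact: h_int.
by apply: (cvg0_integral_iter_TW TW_L1) => //; exact/Lfun1_integrable.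
Qed.

End many_to_one_iterates.

End many_to_one.

(** * Response functions *)

Section responses.
Context {R : realType}.
Implicit Types f : R -> R.

Lemma Fne_le_bsup f z : Fne f -> f z <= bsup f.
Proof.
case=> bf _ _ _; apply: ub_le_sup; last by exists z.
have [M [_ /(_ (M + 1))]] := bf; rewrite ltrDl ltr01 => /(_ isT) fM.
by exists (M + 1) => _ [y _ <-]; rewrite (le_trans (ler_norm _)) // fM.
Qed.

Lemma Fne_ge0 f z : Fne f -> 0 <= f z.
Proof. by case=> _ f0 _ _. Qed.

Lemma bsup_ge0 f : Fne f -> 0 <= bsup f.
Proof. by move=> fF; apply: le_trans (Fne_le_bsup 0 fF); exact: Fne_ge0. Qed.

Lemma Fne_lipschitz f x y : Fne f -> `|f x - f y| <= `|x - y|.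
Proof.
by case=> _ _ _ /(_ (x, y)) /=; rewrite mul1r; apply.
Qed.

(** Monotonicity and continuity make the sublevel sets of (t, y) |-> f_t(y)
    countable unions of rectangles. *)
Lemma Fne_lt f a y : Fne f ->
  f y < a <-> exists q : rat, y < ratr q /\ f (ratr q) < a.
Proof.
move=> fF; split=> [fya|[q [yq fqa]]]; last first.
  by apply: le_lt_trans fqa; case: fF => _ _ fm _; apply/fm/ltW.
have /rat_in_itvoo [q] : y < y + (a - f y) by rewrite ltrDl subr_gt0.
rewrite in_itv /= => /andP[yq qa]; exists q; split => //.
have := Fne_lipschitz (ratr q) y fF.
rewrite (gtr0_norm (_ : 0 < ratr q - y)) ?subr_gt0 // => /(le_trans (ler_norm _)).
by lra.
Qed.

Lemma open_eval_gt (z a : R) : open ([set f | f z < a] : set {uniform R -> R}).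
Proof.
rewrite openE => f /= fza; apply/uniform_nbhs.
exists [set xy : R * R | ball xy.1 (a - f z) xy.2]; split.
  have e0 : 0 < a - f z by rewrite subr_gt0.
  by rewrite -entourage_ballE; exists (a - f z).
move=> g /= /(_ z I); rewrite /ball /= distrC => /(le_lt_trans (ler_norm _)).
by rewrite ltrBrDr subrK.
Qed.

Context d (T : measurableType d) (f : T -> R -> R).
Hypothesis f_Fne : forall t, Fne (f t).
Hypothesis f_measurable : measurable_family f.

Lemma measurable_response d' (U : measurableType d') (g : U -> T) (y : U -> R) :
  measurable_fun setT g -> measurable_fun setT y ->
  measurable_fun setT (fun u => f (g u) (y u)).
Proof.
move=> mg my; apply: (measurability _ (RGenInftyO.measurableE R)).
move=> _ [_ [a ->] <-]; rewrite setTI.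
rewrite [X in measurable X](_ : _ = \bigcup_(q : rat)
    (y @^-1` `]-oo, ratr q[ `&` (g @^-1` ((f ^~ (ratr q)) @^-1` `]-oo, a[)))).
  apply: bigcupT_measurable_rat => q; apply: measurableI.
    by rewrite -[X in measurable X]setTI; exact: my.
  rewrite -[X in measurable X]setTI; apply: mg => //.
  rewrite (_ : _ @^-1` _ = f @^-1` [set h | h (ratr q) < a]).
    exact: f_measurable (open_eval_gt (ratr q) a).
  by apply/seteqP; split => t /=; rewrite in_itv.
apply/seteqP; split => u /=; rewrite in_itv /=.
  move=> /(Fne_lt _ _ (f_Fne _))[q [yq fq]].
  by exists q => //; split; rewrite /= in_itv.
move=> [q _ [/=]]; rewrite !in_itv /= => yq fq.
by apply/(Fne_lt _ _ (f_Fne _)); exists q.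
Qed.

End responses.

(** * Extremal iterates and coalescence *)

Section extremal_iterates.
Context {T : Type} {R : realType}.
Variables (x : mtree T R) (phi : word -> R -> R).
Hypothesis phi_Fne : forall v, Fne (phi v).

Lemma update_homo (y z : word -> R) : (forall v, y v <= z v) ->
  forall v, update x phi y v <= update x phi z v.
Proof.
move=> yz v; case: (phi_Fne v) => _ _ fm _; apply: fm.
by rewrite lerD2r; apply: ler_sum => u _; rewrite ler_wpM2l // weight_ge0.
Qed.

Lemma nondecreasing_xminus v : nondecreasing_seq (fun k => xminus x phi k v).
Proof.
apply/nondecreasing_seqP => k; elim: k v => [|k ih] v; last exact: update_homo.
exact: Fne_ge0.
Qed.

Lemma nonincreasing_xplus v : nonincreasing_seq (fun k => xplus x phi k v).
Proof.
apply/nonincreasing_seqP => k; elim: k v => [|k ih] v; last exact: update_homo.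
exact: Fne_le_bsup.
Qed.

Lemma xminus_le_xplus k v : xminus x phi k v <= xplus x phi k v.
Proof.
elim: k v => [|k ih] v; last exact: update_homo.
exact: bsup_ge0.
Qed.

Lemma xminus_ge0 k v : 0 <= xminus x phi k v.
Proof. exact: (nondecreasing_xminus v (leq0n k)). Qed.

Lemma xplus_le k v : xplus x phi k v <= bsup (phi v).
Proof. exact: (nonincreasing_xplus v (leq0n k)). Qed.

Lemma cvg_xminus v : cvgn (fun k => xminus x phi k v).
Proof.
apply: nondecreasing_is_cvgn; first exact: nondecreasing_xminus.
exists (bsup (phi v)) => _ [k _ <-].
exact: le_trans (xminus_le_xplus k v) (xplus_le k v).
Qed.

Lemma cvg_xplus v : cvgn (fun k => xplus x phi k v).
Proof.
apply: nonincreasing_is_cvgn; first exact: nonincreasing_xplus.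
exists 0 => _ [k _ <-]; exact: le_trans (xminus_ge0 k v) (xminus_le_xplus k v).
Qed.

End extremal_iterates.

Section root_iterates.
Context d (T : measurableType d) (R : realType) (f : T -> R -> R).
Hypothesis f_Fne : forall t, Fne (f t).
Hypothesis f_measurable : measurable_family f.
Notation tree := (mtree T R).

Definition root_minus k (x : tree) := xminus x (fun v => f (typ x v)) k [::].
Definition root_plus k (x : tree) := xplus x (fun v => f (typ x v)) k [::].

Lemma root_minusS k x : root_minus k.+1 x =
  f (root_typ x) (netinput x (fun i => root_minus k (child x i)) + shock x [::]).
Proof. exact: (iter_update_root f (fun=> 0)). Qed.

Lemma root_plusS k x : root_plus k.+1 x =
  f (root_typ x) (netinput x (fun i => root_plus k (child x i)) + shock x [::]).
Proof. exact: (iter_update_root f (@bsup R)). Qed.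

(** One Lipschitz step replaces the gap at the root by the weighted average of
    the gaps at its children. *)
Lemma root_gap_le k x : root_plus k x - root_minus k x <=
  iter k (@propagate d T R) ((fun t => bsup (f t)) \o @root_typ T R) x.
Proof.
elim: k x => [|k ih] x; first by rewrite /root_plus /root_minus /= subr0.
rewrite root_plusS root_minusS (le_trans (ler_norm _)) //.
rewrite (le_trans (Fne_lipschitz _ _ (f_Fne _))) //.
rewrite opprD addrACA subrr addr0 /netinput -sumrB ger0_norm; last first.
  apply: sumr_ge0 => i _; rewrite -mulrBr mulr_ge0 ?weight_ge0 // subr_ge0.
  exact: xminus_le_xplus.
apply: ler_sum => i _; rewrite -mulrBr ler_wpM2l ?weight_ge0 //.
Qed.

Lemma measurable_root_update (F : tree -> R) : measurable_fun setT F ->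
  measurable_fun setT (fun x : tree =>
    f (root_typ x) (netinput x (fun i => F (child x i)) + shock x [::])).
Proof.
move=> mF; apply: measurable_response => //.
apply: measurable_funD; first exact: measurable_netinput_child.
exact: measurable_shock_root.
Qed.

Lemma measurable_root_minus k : measurable_fun setT (root_minus k).
Proof.
elim: k => [|k ih]; first exact: measurable_cst.
by rewrite (funext (root_minusS k)); exact: measurable_root_update.
Qed.

Lemma measurable_root_plus k : measurable_fun setT (fun t => bsup (f t)) ->
  measurable_fun setT (root_plus k).
Proof.
move=> mB; elim: k => [|k ih].
  rewrite (_ : root_plus 0 = (fun t => bsup (f t)) \o @root_typ T R) //.
  exact: measurableT_comp.
by rewrite (funext (root_plusS k)); exact: measurable_root_update.
Qed.

End root_iterates.

Section coalescence.
Context dO d (Omega : measurableType dO) (T : measurableType d) (R : realType).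
Variables (f : T -> R -> R) (P : probability Omega R) (G : {RV P >-> mtree T R}).
Hypothesis f_Fne : forall t, Fne (f t).
Hypothesis f_measurable : measurable_family f.

Let xm k (w : Omega) := root_minus f k (G w).
Let xp k (w : Omega) := root_plus f k (G w).
Let D w := limn (xp ^~ w) - limn (xm ^~ w).

Let mxm k : measurable_fun setT (xm k).
Proof. by apply: (measurableT_comp (measurable_root_minus f_Fne f_measurable k)). Qed.

Lemma measurable_limn_root_minus : measurable_fun setT (fun w => limn (xm ^~ w)).
Proof.
apply: (measurable_fun_cvg (h := xm)) => // w _; exact: cvg_xminus.
Qed.

Section gap.
Variable S : nat -> mtree T R -> R.
Hypothesis mB : measurable_fun setT (fun t => bsup (f t)).
Hypothesis mS : forall k, measurable_fun setT (S k).
Hypothesis gap_le : forall k x, root_plus f k x - root_minus f k x <= S k x.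
Hypothesis S_cvg0 : (\int[P]_w (S k (G w))%:E @[k --> \oo] --> 0)%E.

(** The limit of the gap is nonnegative and below every gap, so its expectation is
    below every E S_k and therefore zero. *)
Lemma ae_eq_limn_root : {ae P, forall w, limn (xp ^~ w) = limn (xm ^~ w)}.
Proof.
have mxp k : measurable_fun setT (xp k).
  by apply: (measurableT_comp (measurable_root_plus f_Fne f_measurable k mB)).
have mD : measurable_fun setT D.
  apply: measurable_funB; last exact: measurable_limn_root_minus.
  by apply: (measurable_fun_cvg (h := xp)) => // w _; exact: cvg_xplus.
have D_le k w : 0 <= D w <= xp k w - xm k w.
  have cm : cvgn (xm ^~ w) by exact: cvg_xminus.
  have cp : cvgn (xp ^~ w) by exact: cvg_xplus.
  rewrite /D subr_ge0; apply/andP; split.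
    by apply: ler_lim => //; apply: nearW => n; exact: xminus_le_xplus.
  apply: lerB.
    by apply: nonincreasing_cvgn_ge => //; exact: nonincreasing_xplus.
  by apply: nondecreasing_cvgn_le => //; exact: nondecreasing_xminus.
have D_ge0 w : 0 <= D w by case/andP: (D_le 0%N w).
have intD0 : (\int[P]_w `|(D w)%:E| = 0)%E.
  apply/eqP; rewrite eq_le integral_ge0 ?andbT //.
  have intDk k : (\int[P]_w `|(D w)%:E| <= \int[P]_w (S k (G w))%:E)%E.
    apply: ge0_le_integral => //.
    - by apply: measurableT_comp => //; exact/measurable_EFinP.
    - by apply/measurable_EFinP; exact: (measurableT_comp (mS k)).
    move=> w _; rewrite gee0_abs ?lee_fin //.
    by case/andP: (D_le k w) => _ /le_trans; apply; exact: gap_le.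
  rewrite -(cvg_lim _ S_cvg0) //; apply: lime_ge; first by apply/cvg_ex; exists 0%E.
  exact: nearW.
have := (ae_eq_integral_abs P measurableT (proj2 (measurable_EFinP _ _) mD)).1 intD0.
by apply: filterS => w /(_ I) [] /eqP; rewrite subr_eq0 => /eqP.
Qed.

End gap.
End coalescence.

Theorem proposition5p2 (R : realType)
  (X : completePseudoMetricType R) (X_hausdorff : hausdorff_space X)
  (X_separable : exists2 D : set X, countable D & dense D)
  (f : borelType X -> R -> R)
  (f_Fne : forall t, Fne (f t)) (f_measurable : measurable_family f)
  (dO : measure_display) (Omega : measurableType dO) (P : probability Omega R)
  (G : {RV P >-> mtree (borelType X) R})
  (K : R.-pker (borelType X) ~> mtree (borelType X) R)
  (K_law : type_conditioned_law G K) (G_branching : branching G K)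
  (B_L1 : (fun t => bsup (f t)) \in Lfun (root_law G) 1%E)
  (Q : R.-ker (borelType X) ~> borelType X) (Q_QW : is_QW G Q)
  (TW_L1 : TW_bounded_positive_on_L1 (root_law G) Q)
  (TW_radius : (spectral_radius (root_law G) Q < 1)%E) :
  let resp := fun (w : Omega) (v : word) => f (typ (G w) v) in
  let xm := fun (k : nat) (w : Omega) => xminus (G w) (resp w) k [::] in
  let xp := fun (k : nat) (w : Omega) => xplus (G w) (resp w) k [::] in
  (exists xstar : {RV P >-> R},
    {ae P, forall w,
      [/\ nondecreasing_seq (xm ^~ w), xm k w @[k --> \oo] --> xstar w,
          nonincreasing_seq (xp ^~ w) & xp k w @[k --> \oo] --> xstar w]}) /\
  {ae P, forall w, xp k w - xm k w @[k --> \oo] --> 0}.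
Proof.
move=> resp xm xp.
have resp_Fne w v : Fne (resp w v) by exact: f_Fne.
have mB : measurable_fun setT (fun t => bsup (f t)).
  by move: B_L1 => /sub_Lfun_mfun; rewrite inE.
have B_ge0 t : 0 <= bsup (f t).
  exact: bsup_ge0.
pose S k := iter k (@propagate _ (borelType X) R)
  ((fun t => bsup (f t)) \o @root_typ (borelType X) R).
have mS k : measurable_fun setT (S k).
  elim: k => [|k ih]; first exact: (measurableT_comp mB).
  exact: measurable_netinput_child.
have S_cvg0 := cvg0_expectation_propagate K_law G_branching Q_QW TW_L1 B_ge0 B_L1
  TW_radius.
have aelim := ae_eq_limn_root f_Fne f_measurable mB mS (root_gap_le f_Fne) S_cvg0.
have mxs : (fun w => limn (xm ^~ w)) \in mfun.
  by rewrite inE; exact: (measurable_limn_root_minus G f_Fne f_measurable).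
have cm w : xm k w @[k --> \oo] --> limn (xm ^~ w) by exact: (cvg_xminus (resp_Fne w)).
have cp w : xp k w @[k --> \oo] --> limn (xp ^~ w) by exact: (cvg_xplus (resp_Fne w)).
split.
  exists (mfun_Sub mxs); apply: filterS aelim => w lim; split.
  - exact: (@nondecreasing_xminus _ _ (G w) _ (resp_Fne w) [::]).
  - exact: cm.
  - exact: (@nonincreasing_xplus _ _ (G w) _ (resp_Fne w) [::]).
  - by rewrite /= -[X in _ --> X]lim; exact: cp.
apply: filterS aelim => w lim; rewrite -(subrr (limn (xm ^~ w))).
by apply: cvgB; [rewrite -[X in _ --> X]lim; exact: cp|exact: cm].
Qed.
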